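(* For every multi-type resource allocation problem in which every agent's preference is lexicographic, the assignment $P=\mathrm{LexiPS}(R)$ is sd-efficient, sd-envy-free, and decomposable.
   Context: Setting: $N=\{1,\dots,n\}$ agents; $M=D_1\cup\dots\cup D_p$ items with pairwise disjoint types $D_i$, $|D_i|=n$, unit supply; bundles $\mathcal D=D_1\times\dots\times D_p$; $x_i$ denotes the type-$i$ component of bundle $x$. An assignment is an $n\times|\mathcal D|$ matrix $P=(p_{j,x})$ with entries in $[0,1]$, each row summing to $1$, and $\sum_j\sum_{x\ni o}p_{j,x}=1$ for each item $o$; discrete if entries are in $\{0,1\}$; decomposable if a convex combination of discrete assignments. Lexicographic preference: agent $j$ has a strict linear order (importance order) $\rhd_j$ over the types $\{1,\dots,p\}$ and, for each type $i$, a strict linear order $\rhd^i_j$ over $D_i$; then $x\succ_j y$ iff there is a type $i$ with $x_i\rhd^i_j y_i$ and $x_{i'}=y_{i'}$ for all types $i'\rhd_j i$. $U(\succ,x)=\{y:y\succ x\}\cup\{x\}$; $p$ weakly stochastically dominates $q$ w.r.t. $\succ$ if $\sum_{y\in U(\succ,x)}p_y\ge\sum_{y\in U(\succ,x)}q_y$ for all $x$. $P$ is sd-efficient if there is no assignment $Q\ne P$ with $Q_j$ weakly stochastically dominating $P_j$ w.r.t. $\succ_j$ for all $j$; $P$ is sd-envy-free if $P_j$ weakly stochastically dominates $P_k$ w.r.t. $\succ_j$ for all $j,k$. LexiPS: remaining supplies of items are initialized to $1$ and carried across phases. There are $p$ phases $k=1,\dots,p$, each lasting one unit of time. In phase $k$,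 every agent $j$ consumes only items of her $k$-th most important type (w.r.t. $\rhd_j$): at each moment she eats, at rate $1$, the item of that type she most prefers under $\rhd^i_j$ among those with positive remaining supply; remaining supplies decrease by the total eating rate on them (agents in different types are independent). Let $s^i_{j,o}$ be the total amount of item $o\in D_i$ eaten by $j$ (so $\sum_{o\in D_i}s^i_{j,o}=1$). The output is $p_{j,x}=\prod_{i=1}^p s^i_{j,x_i}$. *)

(* Defs.v *)
From HB Require Import structures.
From mathcomp Require Import all_boot all_order all_algebra all_fingroup.
Set Implicit Arguments. Unset Strict Implicit. Unset Printing Implicit Defensive.
Import Order.TTheory GRing.Theory Num.Theory.
Local Open Scope ring_scope.

(* Agents are 'I_n, types are 'I_p, and the items of each type are 'I_n
   (item (i, o) is the o-th item of type D_i).  A bundle picks one item of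
   each type.                                                              *)
Definition bundle (n p : nat) := {ffun 'I_p -> 'I_n}.

(* A lexicographic preference profile.  Strict linear orders on a finite set
   of size m are encoded by ranking bijections onto 'I_m (rank 0 = top):
   - imp j i   = position of type i in agent j's importance order;
   - irank j i o = position of item o in agent j's order over D_i.          *)
Record lexprofile (n p : nat) := LexProfile {
  imp : 'I_n -> {perm 'I_p};
  irank : 'I_n -> 'I_p -> {perm 'I_n} }.

Section Defs.
Variables (n p : nat) (L : lexprofile n p).

Definition lexpref (j : 'I_n) : rel (bundle n p) := fun x y =>
  [exists i : 'I_p, (irank L j i (x i) < irank L j i (y i))%N &&
     [forall i' : 'I_p, (imp L j i' < imp L j i)%N ==> (x i' == y i')]].

Variable R : realFieldType.

Definition assignment := {ffun 'I_n -> {ffun bundle n p -> R}}.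

Definition is_assignment (P : assignment) : Prop :=
  [/\ (forall j x, 0 <= P j x <= 1),
      (forall j, \sum_(x : bundle n p) P j x = 1) &
      (forall (i : 'I_p) (o : 'I_n), \sum_(j < n) \sum_(x : bundle n p | x i == o) P j x = 1)].

Definition is_discrete (P : assignment) : Prop :=
  forall j x, P j x = 0 \/ P j x = 1.

Definition decomposable (P : assignment) : Prop :=
  exists (m : nat) (w : 'I_m -> R) (D : 'I_m -> assignment),
    [/\ (forall k, 0 <= w k), \sum_(k < m) w k = 1,
        (forall k, is_assignment (D k) /\ is_discrete (D k)) &
        (forall j x, P j x = \sum_(k < m) w k * D k j x)].

Definition sd_dominates (succ : rel (bundle n p)) (a b : bundle n p -> R) : Prop :=
  forall x : bundle n p,
    \sum_(y : bundle n p | succ y x || (y == x)) b y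
      <= \sum_(y : bundle n p | succ y x || (y == x)) a y.

Definition sd_efficient (P : assignment) : Prop :=
  ~ exists Q : assignment,
      [/\ is_assignment Q, Q <> P & forall j, sd_dominates (lexpref j) (Q j) (P j)].

Definition sd_envy_free (P : assignment) : Prop :=
  forall j k : 'I_n, sd_dominates (lexpref j) (P j) (P k).

(* type eaten by agent j in phase k (k-th most important type, 0-based) *)
Definition ptype (j : 'I_n) (k : 'I_p) : 'I_p := ((imp L j)^-1)%g k.

Definition pref_items (j : 'I_n) (i : 'I_p) : seq 'I_n :=
  [seq ((irank L j i)^-1)%g r | r <- enum 'I_n].

Definition target (sup : 'I_p -> 'I_n -> R) (j : 'I_n) (k : 'I_p) : option 'I_n :=
  ohead [seq o <- pref_items j (ptype j k) | 0 < sup (ptype j k) o].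

Definition eats (sup : 'I_p -> 'I_n -> R) (k : 'I_p) (j : 'I_n) (i : 'I_p) (o : 'I_n) : bool :=
  (ptype j k == i) && (target sup j k == Some o).

Definition rate (sup : 'I_p -> 'I_n -> R) (k : 'I_p) (i : 'I_p) (o : 'I_n) : R :=
  (#|[pred j | eats sup k j i o]|)%:R.

Record psstate := PSState {
  time_left : R;
  supply : 'I_p -> 'I_n -> R;
  eaten : 'I_n -> 'I_p -> 'I_n -> R }.

(* advance the eating process of phase k until the next item is exhausted
   or the phase time runs out *)
Definition ps_step (k : 'I_p) (st : psstate) : psstate :=
  let sup := supply st in
  let delta := \big[Num.min/time_left st]_(io : 'I_p * 'I_n | 0 < rate sup k io.1 io.2)
                 (sup io.1 io.2 / rate sup k io.1 io.2) in
  PSState (time_left st - delta)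
          (fun i o => sup i o - rate sup k i o * delta)
          (fun j i o => eaten st j i o + (if eats sup k j i o then delta else 0)).

(* one phase lasts one unit of time; at most p*n items can be exhausted, so
   (p*n).+1 event steps reach the end of the phase (later steps are no-ops) *)
Definition ps_phase (k : 'I_p) (st : psstate) : psstate :=
  iter (p * n).+1 (ps_step k) (PSState 1 (supply st) (eaten st)).

Definition lexips_shares : 'I_n -> 'I_p -> 'I_n -> R :=
  eaten (foldl (fun st k => ps_phase k st)
               (PSState 1 (fun _ _ => 1) (fun _ _ _ => 0)) (enum 'I_p)).

Definition LexiPS : assignment :=
  [ffun j => [ffun x : bundle n p => \prod_(i < p) lexips_shares j i (x i)]].

End Defs.

(* Main.v *)
Require Import Defs.
From HB Require Import structures.
From mathcomp Require Import all_boot all_order all_algebra all_fingroup.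
From mathcomp Require Import lra.

Set Implicit Arguments.
Unset Strict Implicit.
Unset Printing Implicit Defensive.

Import Order.TTheory GRing.Theory Num.Theory.
Local Open Scope ring_scope.

(* Let [T i o] be the time at which LexiPS exhausts item [o] of type [i], with
   the phase [k] occupying the time interval [k, k+1].  An agent eating type [i]
   in phase [k] eats from a set [A] of items at most the length of
   [k, max_(o in A) T i o] cut down to [0, 1], with equality when [A] is an upper
   set of her own order: she eats from such an [A] as long as it lasts.

   Efficiency: by induction on phases, a dominating assignment [Q] agrees with
   [P] on all masses determined by the types eaten before phase [k].
   Lexicographic dominance then gives dominance of the marginals of the type
   eaten in phase [k].  Going through the items in order of exhaustion, these
   marginals must coincide, and so must all conditional ones.

   Envy-freeness: compare agents [j] and [k] along the importance order of [j].
   As long as both eat the same type in the same phase, [j] gets a dominating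
   share.  At the first discrepancy [k] eats that type later than [j], when
   everything [j] likes at least as much as her last item is gone, except for
   the leftovers of that item.

   Decomposability: by Birkhoff's theorem every type's share matrix is a convex
   combination of permutation matrices; expand the product of these. *)

(** * Truncation of an elapsed time to a unit phase *)

Section Clamp.
Variable R : realFieldType.

(** At [t - k] this is the portion of the phase [[k, k+1]] elapsed by time [t]. *)
Definition clamp (x : R) : R := Num.min 1 (Num.max 0 x).

Lemma clamp_le1 x : clamp x <= 1.
Proof. by rewrite /clamp ge_min lexx. Qed.

Lemma clamp_ge1 x : 1 <= x -> clamp x = 1.
Proof.
by move=> x_ge1; rewrite /clamp max_r ?min_l // (le_trans ler01).
Qed.

Lemma clamp_le0 x : x <= 0 -> clamp x = 0.
Proof. by move=> x_le0; rewrite /clamp max_l ?min_r. Qed.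

Lemma clamp_id x : 0 <= x <= 1 -> clamp x = x.
Proof. by case/andP=> x_ge0 x_le1; rewrite /clamp max_r ?min_r. Qed.

End Clamp.

(** * The eating process: an invariant carried through steps and phases *)

Section EatingProcess.
Variables (R : realFieldType) (n p : nat) (L : lexprofile n p).
Implicit Types (j : 'I_n) (i k : 'I_p) (o : 'I_n) (A : {set 'I_n}).
Implicit Types (tau : 'I_n -> R) (T : 'I_p -> 'I_n -> R) (st : psstate n p R).

(** The default [0] suits the empty set: [clamp (0 - k)] is then [0], like the empty sum of
    shares. *)
Definition latest tau A : R := \big[Num.max/0]_(o in A) tau o.

Definition upper j i A := forall a b,
  a \in A -> (irank L j i b < irank L j i a)%N -> b \in A.

Lemma eats_imp (sup : 'I_p -> 'I_n -> R) k j i o :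
  eats L sup k j i o -> imp L j i = k.
Proof. by case/andP=> /eqP<- _; rewrite /ptype permKV. Qed.

Lemma target_gt0 (sup : 'I_p -> 'I_n -> R) k j o :
  target L sup j k = Some o -> 0 < sup (ptype L j k) o.
Proof.
rewrite /target => eq_o.
have: o \in [seq o <- pref_items L j (ptype L j k) | 0 < sup (ptype L j k) o].
  by case: filter eq_o => //= a s [->]; rewrite inE eqxx.
by rewrite mem_filter => /andP[].
Qed.

Lemma eats_gt0 (sup : 'I_p -> 'I_n -> R) k j i o : eats L sup k j i o -> 0 < sup i o.
Proof. by case/andP=> /eqP<- /eqP /target_gt0. Qed.

Lemma pref_items_sorted j i :
  sorted (fun a b => irank L j i a < irank L j i b)%N (pref_items L j i).
Proof.
rewrite /pref_items sorted_map.
rewrite (eq_sorted (e' := fun a b : 'I_n => (a < b)%N)); last first.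
  by move=> a b /=; rewrite !permKV.
by have := iota_ltn_sorted 0 n; rewrite -val_enum_ord sorted_map.
Qed.

Lemma mem_pref_items j i o : o \in pref_items L j i.
Proof.
by apply/mapP; exists (irank L j i o); rewrite ?mem_enum // permK.
Qed.

Lemma target_best (sup : 'I_p -> 'I_n -> R) k j a : 0 < sup (ptype L j k) a ->
  exists2 o, target L sup j k = Some o &
    (irank L j (ptype L j k) o <= irank L j (ptype L j k) a)%N.
Proof.
set i := ptype L j k => sup_a.
have : a \in [seq o <- pref_items L j i | 0 < sup i o].
  by rewrite mem_filter sup_a mem_pref_items.
have trans : transitive (fun a b => irank L j i a < irank L j i b)%N.
  by move=> ? ? ?; apply: ltn_trans.
have := sorted_filter trans (fun o => 0 < sup i o) (pref_items_sorted j i).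
rewrite /target -/i; case: filter => //= b s sorted_bs.
rewrite inE => /predU1P[-> | a_s]; first by exists b.
exists b => //; apply: ltnW.
by move: sorted_bs; rewrite (path_sortedE trans) => /andP[/allP/(_ _ a_s)].
Qed.

(** At time [t], [T i o] stands for the exhaustion time of [o], or for [t] itself while supply
    remains. The last two fields measure what [j] has eaten from [A] against the part of her phase
    in which [A] was not exhausted. *)
Record ps_inv (t : R) (sup : 'I_p -> 'I_n -> R) (eat : 'I_n -> 'I_p -> 'I_n -> R)
    (T : 'I_p -> 'I_n -> R) : Prop := PSInv {
  supply_ge0 : forall i o, 0 <= sup i o;
  supplyE : forall i o, sup i o = 1 - \sum_j eat j i o;
  eaten_ge0 : forall j i o, 0 <= eat j i o;
  time_le : forall i o, T i o <= t;
  time_supply : forall i o, 0 < sup i o -> T i o = t;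
  eaten_le : forall j i A,
    \sum_(o in A) eat j i o <= clamp (latest (T i) A - (imp L j i)%:R);
  eaten_upper : forall j i A, upper j i A ->
    \sum_(o in A) eat j i o = clamp (latest (T i) A - (imp L j i)%:R) }.

Lemma latest_live t tau A a : 0 <= t -> (forall o, tau o <= t) -> a \in A ->
  tau a = t -> latest tau A = t.
Proof.
move=> t_ge0 tau_le aA tau_a; apply/le_anti/andP; split.
  by apply/bigmax_leP; split.
by apply: (bigmax_sup a) => //; rewrite tau_a.
Qed.

Lemma sum_eats (sup : 'I_p -> 'I_n -> R) k j i A (d : R) c :
  ptype L j k = i -> target L sup j k = Some c ->
  \sum_(o in A) (if eats L sup k j i o then d else 0) = if c \in A then d else 0.
Proof.
move=> jk tgt; rewrite -big_mkcondr /=.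
rewrite (eq_bigl (fun o => (o == c) && (c \in A))); last first.
  move=> o; rewrite /eats jk tgt eqxx /=.
  rewrite (inj_eq Some_inj) eq_sym andbC.
  by case: eqP => [->|].
case: ifP => cA; last by rewrite big1 // => o /andP[].
by rewrite (eq_bigl (pred1 c)) ?big_pred1_eq // => o; rewrite andbT.
Qed.

Lemma sum_eats0 (sup : 'I_p -> 'I_n -> R) k j i A (d : R) :
  (forall o, o \in A -> ~~ eats L sup k j i o) ->
  \sum_(o in A) (if eats L sup k j i o then d else 0) = 0.
Proof. by move=> no; rewrite big1 // => o /no/negPf->. Qed.

Lemma sum_eats_le (sup : 'I_p -> 'I_n -> R) k j i A (d : R) : 0 <= d ->
  \sum_(o in A) (if eats L sup k j i o then d else 0) <= d.
Proof.
move=> d_ge0; case: (boolP [exists o, eats L sup k j i o]) => [/existsP[c] | no].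
  case/andP=> /eqP jk /eqP tgt.
  by rewrite (sum_eats _ _ jk tgt); case: ifP.
rewrite sum_eats0 // => o _; apply: contra no => eo; by apply/existsP; exists o.
Qed.

Lemma rate_gt0 (sup : 'I_p -> 'I_n -> R) k i o :
  0 < rate L sup k i o -> 0 < sup i o.
Proof.
by rewrite /rate ltr0n => /card_gt0P[j]; rewrite inE => /eats_gt0.
Qed.

Lemma rate_ge0 (sup : 'I_p -> 'I_n -> R) k i o : 0 <= rate L sup k i o.
Proof. exact: ler0n. Qed.

Lemma rateE (sup : 'I_p -> 'I_n -> R) k i o (d : R) :
  \sum_j (if eats L sup k j i o then d else 0) = rate L sup k i o * d.
Proof.
rewrite -big_mkcond /= sumr_const /rate mulr_natl.
by congr (_ *+ _); apply: eq_card.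
Qed.

Definition ps_delta k (st : psstate n p R) : R :=
  \big[Num.min/time_left st]_(io : 'I_p * 'I_n | 0 < rate L (supply st) k io.1 io.2)
     (supply st io.1 io.2 / rate L (supply st) k io.1 io.2).

Lemma ps_delta_ge0 k st : 0 <= time_left st -> 0 <= ps_delta k st.
Proof.
move=> t_ge0; apply/bigmin_geP; split=> // io r_gt0.
by rewrite divr_ge0 ?ltW // (rate_gt0 r_gt0).
Qed.

Lemma ps_delta_supply k st i o : 0 <= supply st i o ->
  rate L (supply st) k i o * ps_delta k st <= supply st i o.
Proof.
move=> s_ge0; have := rate_ge0 (supply st) k i o.
rewrite le_eqVlt => /predU1P[<- | r_gt0]; first by rewrite mul0r.
rewrite mulrC -ler_pdivlMr //.
by apply: (bigmin_inf (i, o)).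
Qed.

(** Only the times of live items move. For a set with no live item neither side of the bounds
    changes; otherwise [latest] goes from [t] to [t + d], and [clamp] grows by [d] if [i] is the
    type of phase [k] and not at all if it is not. *)
Lemma ps_step_inv k st T (t := k.+1%:R - time_left st) :
    0 <= time_left st <= 1 -> ps_inv t (supply st) (eaten st) T ->
  exists T', ps_inv (t + ps_delta k st) (supply (ps_step L k st))
    (eaten (ps_step L k st)) T'.
Proof.
case/andP=> l_ge0 l_le1 inv.
have d_ge0 := ps_delta_ge0 k l_ge0.
have d_le : ps_delta k st <= time_left st by apply: bigmin_le_id.
set d := ps_delta k st in d_ge0 d_le *.
have t_ge : k%:R <= t by rewrite /t -natr1; lra.
have t_ge0 : 0 <= t by apply: le_trans t_ge; apply: ler0n.
have td_le : t + d <= k.+1%:R by rewrite /t; lra.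
clearbody t.
exists (fun i o => if 0 < supply st i o then t + d else T i o).
set T' := fun i o => _.
have T'_le i o : T' i o <= t + d.
  by rewrite /T'; case: ifP => // _; have := time_le inv i o; lra.
have supE i o : supply (ps_step L k st) i o =
    supply st i o - rate L (supply st) k i o * d by [].
have eatE j i o : eaten (ps_step L k st) j i o =
    eaten st j i o + (if eats L (supply st) k j i o then d else 0) by [].
have key j i A : exists2 inc, \sum_(o in A) eaten (ps_step L k st) j i o =
      \sum_(o in A) eaten st j i o + inc &
    (clamp (latest (T i) A - (imp L j i)%:R) + inc
       <= clamp (latest (T' i) A - (imp L j i)%:R)) /\
    (upper j i A -> clamp (latest (T i) A - (imp L j i)%:R) + inc
       = clamp (latest (T' i) A - (imp L j i)%:R)).
  exists (\sum_(o in A) (if eats L (supply st) k j i o then d else 0)).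
    by rewrite -big_split.
  case: (boolP [exists o in A, 0 < supply st i o]) => [|dead]; last first.
    have dead' o : o \in A -> (0 < supply st i o) = false.
      by move=> oA; apply: contraNF dead => so; apply/existsP; exists o; rewrite oA.
    rewrite sum_eats0; last first.
      by move=> o /dead' so; apply: contraFN so => /eats_gt0.
    rewrite addr0; suff -> : latest (T' i) A = latest (T i) A by [].
    by apply: eq_bigr => o /dead'; rewrite /T' => ->.
  case/exists_inP=> a aA sa.
  rewrite (latest_live t_ge0 _ aA (time_supply inv sa)); last exact: (time_le inv).
  rewrite (latest_live (t := t + d) _ _ aA) ?addr_ge0 //; last by rewrite /T' sa.
  (* Type [i] is over, not yet begun, or being eaten: [clamp] stays at [1], stays at [0], or is the
     identity. *)
  have [imp_lt | imp_gt | imp_eq] := ltngtP (imp L j i) k.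
  - rewrite sum_eats0 => [|o _]; last first.
      by apply: contraL imp_lt => /eats_imp ->; rewrite ltnn.
    have : (imp L j i)%:R + 1 <= k%:R :> R by rewrite natr1 ler_nat.
    move=> le1; rewrite !clamp_ge1 ?addr0 //; lra.
  - rewrite sum_eats0 => [|o _]; last first.
      by apply: contraL imp_gt => /eats_imp ->; rewrite ltnn.
    have : k.+1%:R <= (imp L j i)%:R :> R by rewrite ler_nat.
    move=> le1; rewrite !clamp_le0 ?addr0 //; lra.
  have {}imp_eq : imp L j i = k by apply: val_inj.
  have jk : ptype L j k = i by rewrite /ptype -imp_eq permK.
  rewrite imp_eq; rewrite -natr1 in td_le; rewrite !clamp_id; try lra.
  have inc_le := @sum_eats_le (supply st) k j i A d d_ge0.
  split=> [|upA]; first lra.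
  have [] := @target_best (supply st) k j a; first by rewrite jk.
  move=> c tgt; rewrite jk => rk_c.
  rewrite (sum_eats _ _ jk tgt).
  (* Her target ranks no worse than the live item [a] of [A], so an upper [A] contains it and
     receives the whole of [d]. *)
  suff -> : c \in A by lra.
  move: rk_c; rewrite leq_eqVlt => /predU1P[/val_inj/perm_inj-> //|].
  exact: upA aA.
split.
- by move=> i o; rewrite supE subr_ge0 ps_delta_supply // (supply_ge0 inv).
- move=> i o; rewrite supE (supplyE inv) -rateE -addrA -opprD -big_split /=.
  by congr (1 - _); apply: eq_bigr => j _.
- move=> j i o; rewrite eatE addr_ge0 ?(eaten_ge0 inv) //.
  by case: ifP.
- exact: T'_le.
- move=> i o; rewrite supE /T' => s_gt0.
  suff -> : 0 < supply st i o by [].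
  by have := mulr_ge0 (rate_ge0 (supply st) k i o) d_ge0; lra.
- move=> j i A; have [inc -> [le_inc _]] := key j i A.
  by apply: le_trans le_inc; rewrite lerD2r (eaten_le inv).
- move=> j i A upA; have [inc -> [_ <- //]] := key j i A.
  by rewrite (eaten_upper inv).
Qed.

Definition live (st : psstate n p R) := [set io : 'I_p * 'I_n | 0 < supply st io.1 io.2].

Lemma ps_delta_attained k st : ps_delta k st = time_left st \/
  exists2 io : 'I_p * 'I_n, 0 < rate L (supply st) k io.1 io.2 &
    ps_delta k st = supply st io.1 io.2 / rate L (supply st) k io.1 io.2.
Proof.
rewrite /ps_delta; elim/big_rec: _ => [|io d r_gt0 IH]; first by left.
by case: leP => _ //; right; exists io.
Qed.

(** An item attaining the minimum in [ps_delta] is exhausted by the step, and no dead item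
    revives. *)
Lemma ps_step_progress k st :
    0 <= time_left st -> (forall i o, 0 <= supply st i o) ->
  time_left (ps_step L k st) = 0 \/ (#|live (ps_step L k st)| < #|live st|)%N.
Proof.
move=> l_ge0 s_ge0; have d_ge0 := ps_delta_ge0 k l_ge0.
have tE : time_left (ps_step L k st) = time_left st - ps_delta k st by [].
have supE i o : supply (ps_step L k st) i o =
    supply st i o - rate L (supply st) k i o * ps_delta k st by [].
case: (ps_delta_attained k st) => [d_eq|[[i o] /= r_gt0 d_eq]].
  by left; rewrite tE d_eq subrr.
right; apply/proper_card/properP; split.
  apply/subsetP=> [[i' o']]; rewrite !in_set supE => s_gt0.
  by have := mulr_ge0 (rate_ge0 (supply st) k i' o') d_ge0; lra.
exists (i, o); rewrite in_set ?(rate_gt0 r_gt0) //.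
by rewrite supE d_eq mulrC divfK ?subrr ?ltxx // gt_eqF.
Qed.

Lemma ps_step_time_left k st : 0 <= time_left st <= 1 ->
  0 <= time_left (ps_step L k st) <= 1.
Proof.
case/andP=> l_ge0 l_le1; have d_ge0 := ps_delta_ge0 k l_ge0.
have d_le : ps_delta k st <= time_left st by apply: bigmin_le_id.
have -> : time_left (ps_step L k st) = time_left st - ps_delta k st by [].
by apply/andP; split; lra.
Qed.

Lemma ps_iter_inv k st T m : time_left st = 1 ->
    ps_inv k%:R (supply st) (eaten st) T ->
  forall st', st' = iter m (ps_step L k) st ->
  [/\ 0 <= time_left st' <= 1,
      exists T', ps_inv (k.+1%:R - time_left st') (supply st') (eaten st') T' &
      time_left st' = 0 \/ (#|live st'| + m <= #|live st|)%N].
Proof.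
move=> l1 inv; elim: m => [|m IH] _ ->.
  split => /=; [by rewrite l1 ler01 lexx| | by right; rewrite addn0].
  by exists T; rewrite l1 -natr1 addrK.
rewrite iterS; move: (iter m _ _) (IH _ erefl) => {IH} st' [l_ge [T' inv'] prog].
have [l_ge0 _] := andP l_ge.
split; first exact: ps_step_time_left.
  have [T2 inv2] := ps_step_inv l_ge inv'; exists T2.
  suff <- : k.+1%:R - time_left st' + ps_delta k st' =
    k.+1%:R - time_left (ps_step L k st') by [].
  by rewrite -addrA; congr (_ + _); rewrite addrC -opprB.
case: prog => [l0 | prog].
  left; have d_ge0 := ps_delta_ge0 k l_ge0.
  have d_le : ps_delta k st' <= time_left st' by apply: bigmin_le_id.
  have -> : time_left (ps_step L k st') = time_left st' - ps_delta k st' by [].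
  lra.
have [->|lt] := ps_step_progress k l_ge0 (supply_ge0 inv'); first by left.
by right; rewrite addnS; apply: leq_trans prog; rewrite -addSn leq_add2r.
Qed.

Lemma ps_phase_inv k st T : ps_inv k%:R (supply st) (eaten st) T ->
  exists T', ps_inv k.+1%:R (supply (ps_phase L k st)) (eaten (ps_phase L k st)) T'.
Proof.
move=> inv.
have [|] := @ps_iter_inv k (PSState 1 (supply st) (eaten st)) T (p * n).+1 _ inv _ erefl.
  by [].
(* If time were left, [(p * n).+1] items would have been exhausted, more than there are. *)
rewrite -/(ps_phase L k st) => _ [T' inv'] [l0 | le]; last first.
  have := leq_trans (leq_addl _ _) le; rewrite ltnNge => /negP[].
  by rewrite (leq_trans (max_card _)) // card_prod !card_ord.
by exists T'; rewrite l0 subr0 in inv'.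
Qed.

Lemma lexips_inv : exists sup T, ps_inv p%:R sup (lexips_shares L R) T.
Proof.
rewrite /lexips_shares.
set st0 := PSState _ _ _.
have inv0 : ps_inv 0%:R (supply st0) (eaten st0) (fun _ _ => 0).
  have lat0 A : latest (fun=> 0) A = 0.
    by rewrite /latest; apply: bigmax_eq_id.
  split=> //= [i o|j i A|j i A _]; first by rewrite big1 ?subr0.
    by rewrite lat0 big1 // clamp_le0 // sub0r oppr_le0 ler0n.
  by rewrite lat0 big1 // clamp_le0 // sub0r oppr_le0 ler0n.
have foldinv s m st T : map val s = iota m (size s) ->
    ps_inv m%:R (supply st) (eaten st) T ->
  exists sup T', ps_inv (m + size s)%:R sup
    (eaten (foldl (fun st k => ps_phase L k st) st s)) T'.
  elim: s m st T => [|k s IH] m st T /=.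
    by exists (supply st), T; rewrite addn0.
  case=> <- vs inv.
  have [T' inv'] := ps_phase_inv inv.
  by rewrite -addSnnS; apply: (IH _ _ T').
have [|sup [T inv]] := foldinv (enum 'I_p) 0%N st0 (fun _ _ => 0) _ inv0.
  by rewrite val_enum_ord size_enum_ord.
by exists sup, T; rewrite size_enum_ord in inv.
Qed.

(* [T i o] is the time at which item [o] of type [i] is exhausted. *)
Record eating_shares (s : 'I_n -> 'I_p -> 'I_n -> R) T : Prop := EatingShares {
  shares_ge0 : forall j i o, 0 <= s j i o;
  shares_row : forall j i, \sum_o s j i o = 1;
  shares_col : forall i o, \sum_j s j i o = 1;
  shares_le : forall j i A,
    \sum_(o in A) s j i o <= clamp (latest (T i) A - (imp L j i)%:R);
  shares_upper : forall j i A, upper j i A ->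
    \sum_(o in A) s j i o = clamp (latest (T i) A - (imp L j i)%:R) }.

(** A live item of type [i] at the end would mean that every agent has eaten a full unit of that
    type, which uses up its total supply [n]. So all supply is gone, and this forces every row, at
    most [1], to equal [1]. *)
Lemma lexips_eating : exists T, eating_shares (lexips_shares L R) T.
Proof.
have [sup [T inv]] := lexips_inv; exists T.
set s := lexips_shares L R in inv *.
have row_le j i : \sum_o s j i o <= 1.
  have := eaten_le inv j i setT; rewrite (eq_bigl predT) => [|o]; last by rewrite inE.
  by move/le_trans; apply; apply: clamp_le1.
have total i : \sum_o sup i o = n%:R - \sum_j \sum_o s j i o.
  rewrite exchange_big /= (eq_bigr (fun o => 1 - \sum_j s j i o)); last first.
    by move=> o _; rewrite (supplyE inv).
  by rewrite sumrB sumr_const card_ord.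
have row_live j i o : 0 < sup i o -> \sum_o s j i o = 1.
  move=> sup_o; have := @eaten_upper _ _ _ _ inv j i setT.
  rewrite (eq_bigl predT) => [->|a]; [|by move=> *; rewrite inE|by rewrite inE].
  rewrite (@latest_live p%:R (T i) setT o) ?ler0n ?inE //.
  - by apply: clamp_ge1; rewrite lerBrDr nat1r ler_nat.
  - exact: (time_le inv).
  - exact: (time_supply inv).
have sup0 i o : sup i o = 0.
  apply/eqP; rewrite eq_le (supply_ge0 inv) andbT leNgt; apply/negP => sup_o.
  have := total i; rewrite [X in _ - X](eq_bigr (fun=> 1)) => [|j _]; last exact: row_live sup_o.
  rewrite sumr_const card_ord subrr => /eqP.
  rewrite psumr_eq0 => [/allP/(_ o)|a _]; last exact: (supply_ge0 inv).
  by rewrite mem_index_enum => /(_ isT)/eqP so; rewrite so ltxx in sup_o.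
split.
- exact: (eaten_ge0 inv).
- move=> j i; have := total i; rewrite big1 => [/eqP|o _]; last exact: sup0.
  rewrite -[n in n%:R]card_ord -sumr_const -sumrB eq_sym.
  rewrite psumr_eq0 => [/allP/(_ j)|a _]; last by rewrite subr_ge0.
  by rewrite mem_index_enum subr_eq0 => /(_ isT)/eqP.
- by move=> i o; have /eqP := supplyE inv i o; rewrite sup0 eq_sym subr_eq0 => /eqP.
- exact: (eaten_le inv).
- exact: (eaten_upper inv).
Qed.
End EatingProcess.

(** * Consequences of the formula for shares within one type *)

Section EatingShares.
Variables (R : realFieldType) (n p : nat) (L : lexprofile n p).
Variables (s : 'I_n -> 'I_p -> 'I_n -> R) (T : 'I_p -> 'I_n -> R).
Hypothesis es : eating_shares L s T.
Implicit Types (j k : 'I_n) (i : 'I_p) (o : 'I_n) (r : nat).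

Definition top j i r : {set 'I_n} := [set o | irank L j i o < r]%N.

Lemma upper_top j i r : upper L j i (top j i r).
Proof. by move=> a b; rewrite !inE => lt_a /ltn_trans; apply. Qed.

Lemma top_rank j i o : top j i (irank L j i o).+1 = o |: top j i (irank L j i o).
Proof.
apply/setP=> a; rewrite !inE ltnS leq_eqVlt; congr (_ || _).
by rewrite (inj_eq val_inj) (inj_eq perm_inj).
Qed.

Lemma sum_top_rank (f : 'I_n -> R) j i o :
  \sum_(a in top j i (irank L j i o).+1) f a =
  f o + \sum_(a in top j i (irank L j i o)) f a.
Proof. by rewrite top_rank big_setU1 // inE ltnn. Qed.

Lemma share_le_top j i r : \sum_(o in top j i r) s j i o <= 1.
Proof. by rewrite (shares_upper es) ?clamp_le1 //; apply: upper_top. Qed.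

(** When both eat type [i] in the same phase, the bound on the share of [k] is the value that [j]
    attains, [top j i r] being upper for [j]. *)
Lemma share_envy_free j k i r : imp L k i = imp L j i ->
  \sum_(o in top j i r) s k i o <= \sum_(o in top j i r) s j i o.
Proof.
move=> imp_eq; rewrite (shares_upper es (@upper_top _ _ _)) -imp_eq.
exact: shares_le.
Qed.

(** A total below [1] means that these items run out before the phase of [j] ends, hence before the
    later phase of [k] begins. *)
Lemma share_later_eq0 j k i r : (imp L j i < imp L k i)%N ->
  \sum_(o in top j i r) s j i o < 1 -> \sum_(o in top j i r) s k i o = 0.
Proof.
move=> imp_lt; rewrite (shares_upper es (@upper_top _ _ _)) => lt1.
apply/le_anti; rewrite sumr_ge0 ?andbT => [|o _]; last exact: shares_ge0 es _ _ _.
apply: le_trans (shares_le es _ _ _) _.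
rewrite clamp_le0 // subr_le0.
have : (imp L j i)%:R + 1 <= (imp L k i)%:R :> R by rewrite natr1 ler_nat.
apply: le_trans; rewrite -lerBlDl leNgt; apply/negP => gt1.
by move: lt1; rewrite clamp_ge1 ?ltxx // ltW.
Qed.

(** Were [a] to last at least as long as [o], adding [o] to the items that [j] ranks above it would
    leave [latest] unchanged, and her share of [o] would vanish. *)
Lemma share_gt0_time j i o a : 0 < s j i o ->
  (irank L j i a < irank L j i o)%N -> T i a < T i o.
Proof.
move=> s_gt0 rk_lt; rewrite ltNge; apply/negP => T_le.
have := sum_top_rank (s j i) j i o.
rewrite !(shares_upper es (@upper_top _ _ _)).
suff -> : latest (T i) (top j i (irank L j i o).+1) =
    latest (T i) (top j i (irank L j i o)) by lra.
apply/le_anti/andP; split; apply/bigmax_leP; rewrite bigmax_ge_id; split=> // b.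
  rewrite top_rank => /setU1P[->|b_top].
    by apply: (bigmax_sup a); rewrite ?inE.
  exact: (bigmax_sup b).
by move=> b_top; apply: (bigmax_sup b); rewrite // top_rank setU1r.
Qed.

Lemma share_gt0_imp j i o : 0 < s j i o -> (imp L j i)%:R < T i o.
Proof.
move=> s_gt0; rewrite ltNge; apply/negP => T_le.
have := shares_le es j i [set o]; rewrite big_set1 /latest bigmax_set1.
rewrite clamp_le0; first by rewrite leNgt s_gt0.
by rewrite subr_le0 ge_max T_le ler0n.
Qed.

Section Dominating.
Variables (q : 'I_n -> 'I_p -> 'I_n -> R) (m : nat).
Hypothesis q_ge0 : forall j i o, 0 <= q j i o.
Hypothesis q_row : forall j i, \sum_o q j i o = 1.
Hypothesis q_col : forall i o, \sum_j q j i o = 1.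
Hypothesis q_dom : forall j i r, (imp L j i <= m)%N -> (r <= n)%N ->
  \sum_(o in top j i r) s j i o <= \sum_(o in top j i r) q j i o.

(* Induction on the exhaustion time of [o]: whoever eats [o] finds all items
   she likes better exhausted earlier, so dominance gives her at least as much
   of [o] in [q]; the unit supply of [o] then forces equality for everyone. *)
Lemma dominating_exhausted i o j : T i o <= m.+1%:R -> q j i o = s j i o.
Proof.
have [N] := ubnP #|[set a | T i a < T i o]|.
elim: N o j => // N IH o j; rewrite ltnS => card_le T_le.
have s_le k : s k i o <= q k i o.
  have [s_le0|s_gt0] := leP (s k i o) 0; first exact: le_trans (q_ge0 _ _ _).
  (* [k] starts eating before [o] is exhausted, so in phase [m] or earlier, where [q_dom]
     applies. *)
  have imp_le : (imp L k i <= m)%N.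
    by rewrite -ltnS -(ltr_nat R); apply: lt_le_trans T_le; apply: share_gt0_imp.
  have := @q_dom k i (irank L k i o).+1 imp_le (ltn_ord _).
  rewrite !sum_top_rank (eq_bigr (q k i)) ?lerD2r // => a.
  rewrite inE => /(share_gt0_time s_gt0) T_lt; symmetry; apply: IH; last first.
    exact: le_trans (ltW T_lt) T_le.
  apply: leq_trans card_le; apply/proper_card/properP; split.
    by apply/subsetP=> b; rewrite !inE => /lt_trans; apply.
  by exists a; rewrite inE ?ltxx.
have /eqP : \sum_k (q k i o - s k i o) = 0.
  by rewrite sumrB q_col (shares_col es) subrr.
rewrite psumr_eq0 => [/allP/(_ j)|k _]; last by rewrite subr_ge0.
by rewrite mem_index_enum subr_eq0 => /(_ isT)/eqP.
Qed.

(** If all the items are exhausted by time [m.+1], the shares coincide one by one. An item lasting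
    longer outlives the phase of [j], so her share of the set is already [1], the most that [q] can
    give. *)
Lemma dominating_top j i r : (imp L j i <= m)%N -> (r <= n)%N ->
  \sum_(o in top j i r) q j i o = \sum_(o in top j i r) s j i o.
Proof.
move=> imp_le r_le.
case: (boolP [exists o in top j i r, m.+1%:R < T i o]) => [|no]; last first.
  apply: eq_bigr => o o_top; apply: dominating_exhausted.
  by rewrite leNgt; apply: contra no => T_lt; apply/exists_inP; exists o.
case/exists_inP=> o o_top T_lt; apply/le_anti; rewrite q_dom // andbT.
rewrite (shares_upper es (@upper_top _ _ _)) clamp_ge1; last first.
  rewrite lerBrDr nat1r; apply: (bigmax_sup o) => //.
  by rewrite (le_trans _ (ltW T_lt)) // ler_nat.
rewrite -(q_row j i) [leRHS](bigID [in top j i r]) /= lerDl sumr_ge0 //.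
Qed.

End Dominating.

End EatingShares.

(** * Lexicographic upper contour sets, one type at a time *)

Section LexOrder.
Variables (R : realFieldType) (n p : nat) (L : lexprofile n p) (j : 'I_n).
Implicit Types (x y z : bundle n p) (i : 'I_p) (f g : bundle n p -> R) (m : nat).

Definition agree m y x := [forall i, (imp L j i < m)%N ==> (y i == x i)].

Definition lexle y x := lexpref L j y x || (y == x).

Lemma agreeP m y x :
  reflect (forall i, (imp L j i < m)%N -> y i = x i) (agree m y x).
Proof.
apply: (iffP forallP) => eq_yx i; first by move/(implyP (eq_yx i))/eqP.
by apply/implyP=> /eq_yx ->.
Qed.

Lemma agree0 y x : agree 0 y x.
Proof. exact/agreeP. Qed.

Lemma agree_full m y x : (p <= m)%N -> agree m y x = (y == x).
Proof.
move=> le_pm; apply/agreeP/eqP => [eq_yx|-> //].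
by apply/ffunP=> i; apply: eq_yx; apply: leq_trans le_pm.
Qed.

Lemma agreeS i y x :
  agree (imp L j i).+1 y x = agree (imp L j i) y x && (y i == x i).
Proof.
apply/agreeP/andP => [eq_yx|[/agreeP eq_yx /eqP eq_i] i'].
  by split; [apply/agreeP=> i' /ltnW/eq_yx|rewrite eq_yx].
by rewrite ltnS leq_eqVlt => /predU1P[/val_inj/perm_inj->|/eq_yx].
Qed.

Lemma lexleS i y x : agree (imp L j i) y x ->
  lexle y x = (irank L j i (y i) < irank L j i (x i))%N ||
              agree (imp L j i).+1 y x && lexle y x.
Proof.
move=> agr; rewrite agreeS agr /=.
have [lt_i|ge_i] /= := ltnP.
  apply/orP; left; apply/existsP; exists i; rewrite lt_i.
  by apply/forallP=> i'; apply/implyP=> /(agreeP _ _ _ agr) ->.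
case: eqVneq => //= ne_i; apply/negbTE; rewrite negb_or.
apply/andP; split; last by apply: contra_neq ne_i => ->.
apply/negP=> /existsP[i' /andP[lt_i' /forallP agr']].
have [imp_lt|imp_gt|imp_eq] := ltngtP (imp L j i) (imp L j i').
- by have /implyP/(_ imp_lt) := agr' i; rewrite (negPf ne_i).
- by rewrite (agreeP _ _ _ agr) ?ltnn in lt_i'.
have eq_i := perm_inj (val_inj imp_eq); rewrite -eq_i in lt_i'.
by rewrite ltnNge ge_i in lt_i'.
Qed.

Lemma lexle_sumS f i x :
  \sum_(y | agree (imp L j i) y x && lexle y x) f y =
  \sum_(y | agree (imp L j i) y x &&
            (irank L j i (y i) < irank L j i (x i))%N) f y +
  \sum_(y | agree (imp L j i).+1 y x && lexle y x) f y.
Proof.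
rewrite (bigID (fun y => irank L j i (y i) < irank L j i (x i))%N) /=.
congr (_ + _); apply: eq_bigl => y.
  case: (boolP (agree _ y x)) => //= agr; rewrite (lexleS agr).
  by case: ltnP; rewrite ?andbT ?andbF.
case: (boolP (agree (imp L j i) y x)) => [agr|]; last first.
  by rewrite agreeS => /negPf->.
rewrite {1}(lexleS agr) agreeS agr /=.
by case: ltnP => //=; rewrite ?andbT //; case: eqP => //= ->; rewrite ltnn.
Qed.

Lemma lexle_sum_full f x : \sum_(y | agree p y x && lexle y x) f y = f x.
Proof.
rewrite (eq_bigl (pred1 x)) ?big_pred1_eq // => y.
by rewrite agree_full //= /lexle; case: eqP => // ->; rewrite orbT.
Qed.

(* Replacing by the worst item every component of [x] that is less important
   than [i] makes the upper contour set at [x] depend on [i] only. *)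
Lemma lexle_worst i x (w : forall i', 'I_n) :
    (forall i' a, irank L j i' a <= irank L j i' (w i'))%N ->
  let x' := [ffun i' => if (imp L j i' <= imp L j i)%N then x i' else w i'] in
  forall y, agree (imp L j i) y x' && lexle y x' =
    agree (imp L j i) y x && (irank L j i (y i) <= irank L j i (x i))%N.
Proof.
move=> worst x' y.
have x'E i' : (imp L j i' <= imp L j i)%N -> x' i' = x i'.
  by move=> le; rewrite ffunE le.
have -> : agree (imp L j i) y x' = agree (imp L j i) y x.
  by apply/agreeP/agreeP => agr i' lt; rewrite agr ?x'E // ltnW.
case: (boolP (agree _ y x)) => //= agr.
have agr' : agree (imp L j i) y x'.
  by apply/agreeP=> i' lt; rewrite (agreeP _ _ _ agr) ?x'E // ltnW.
rewrite (lexleS agr') x'E //; have [lt_i|ge_i] /= := ltnP (irank L j i (y i)) (irank L j i (x i)).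
  by rewrite ltnW.
rewrite agreeS agr' x'E //=.
have -> : (irank L j i (y i) <= irank L j i (x i))%N = (y i == x i).
  by rewrite -(inj_eq (@perm_inj _ (irank L j i))) -(inj_eq val_inj) eqn_leq ge_i andbT.
case: eqP => //= eq_i; rewrite /lexle.
case: (eqVneq y x') => [_|ne]; first by rewrite orbT.
rewrite orbF; have [i0 ne0] : exists i0, y i0 != x' i0.
  apply/existsP; rewrite -negb_forall; apply: contra ne => /forallP eq.
  by apply/eqP/ffunP=> i0; apply/eqP.
(* [i1] is the most important type where [y] and [x'] differ. It is less important than [i], so [x']
   has the worst item there and [y] a strictly better one. *)
case: (@arg_minnP _ i0 (fun i0 => y i0 != x' i0) (fun i0 => imp L j i0) ne0) => i1 ne1 min1.
apply/existsP; exists i1; apply/andP; split; last first.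
  by apply/forallP=> i'; apply/implyP; rewrite ltnNge; apply: contraR; apply: min1.
rewrite ltn_neqAle (inj_eq val_inj) (inj_eq perm_inj) ne1 /=.
rewrite ffunE ifF //; apply/negbTE; rewrite -ltnNge ltnNge.
apply: contra ne1; rewrite leq_eqVlt => /predU1P[/val_inj/perm_inj->|lt].
  by rewrite x'E // eq_i.
by rewrite (agreeP _ _ _ agr').
Qed.

(** The fixed points of [trunc m x] represent the classes of [agree m], whatever the base bundle
    [x]; [sum_agree] splits a sum over these classes. *)
Definition trunc m x y : bundle n p :=
  [ffun i => if (imp L j i < m)%N then y i else x i].

Lemma truncE m x y z : trunc m x z = z -> (trunc m x y == z) = agree m y z.
Proof.
move=> tz; apply/eqP/agreeP => [<- i lt_i|agr]; first by rewrite ffunE lt_i.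
by rewrite -tz; apply/ffunP=> i; rewrite !ffunE; case: ifP => // /agr.
Qed.

Lemma trunc_id m x y : trunc m x (trunc m x y) = trunc m x y.
Proof. by apply/ffunP=> i; rewrite !ffunE; case: ltnP. Qed.

Lemma sum_agree f m x (C : pred (bundle n p)) :
  \sum_(y | C y) f y =
  \sum_(z | trunc m x z == z) \sum_(y | agree m y z && C y) f y.
Proof.
rewrite (partition_big (trunc m x) (fun z => trunc m x z == z)) /=; last first.
  by move=> y _; rewrite trunc_id eqxx.
apply: eq_bigr => z /eqP tz; apply: eq_bigl => y.
by rewrite truncE // andbC.
Qed.

End LexOrder.

(** * Product measures on bundles and their upper contour masses *)

Section ProductMeasure.
Variables (R : realFieldType) (n p : nat).
Implicit Types (u : 'I_p -> 'I_n -> R) (i : 'I_p).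

Definition prodm u (y : bundle n p) : R := \prod_i u i (y i).

Lemma sum_prodm u (F : 'I_p -> pred 'I_n) :
  \sum_(y : bundle n p | [forall i, F i (y i)]) prodm u y = \prod_i \sum_(o | F i o) u i o.
Proof.
rewrite bigA_distr_big_dep; apply: eq_bigl => y.
by apply/forallP/familyP.
Qed.

Lemma sum_prodm1 u : (forall i, \sum_o u i o = 1) -> \sum_y prodm u y = 1.
Proof.
move=> u1; rewrite -(bigA_distr_bigA u) big1 // => i _.
Qed.

Lemma prodm_marginal u i (C : pred 'I_n) : (forall i, \sum_o u i o = 1) ->
  \sum_(y : bundle n p | C (y i)) prodm u y = \sum_(o | C o) u i o.
Proof.
move=> u1; have := sum_prodm u (fun i' o => (i' == i) ==> C o).
rewrite (bigD1 i) //= [X in _ * X]big1 ?mulr1 => [|i' /negPf ne]; last first.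
  by rewrite -[RHS](u1 i'); apply: eq_bigl => o; rewrite ne.
rewrite (eq_bigl (fun o => C o)) => [<-|o]; last by rewrite eqxx.
apply: eq_bigl => y; apply/idP/forallP => [Cy i'|/(_ i)]; last by rewrite eqxx.
by apply/implyP=> /eqP->.
Qed.

Variables (L : lexprofile n p) (j : 'I_n).

Definition prefixm u m (x : bundle n p) : R := \prod_(i | (imp L j i < m)%N) u i (x i).

Lemma prefixmS u i x :
  prefixm u (imp L j i).+1 x = prefixm u (imp L j i) x * u i (x i).
Proof.
rewrite /prefixm (bigD1 i) ?leqnn //= mulrC; congr (_ * _).
apply: eq_bigl => i'; rewrite ltnS leq_eqVlt (inj_eq val_inj) (inj_eq perm_inj).
by case: eqVneq => [->|]; rewrite ?ltnn //= andbT.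
Qed.

(** The event is a box: single items for the types before [i], a top set at [i], no constraint
    later. *)
Lemma sum_prodm_agree u i x r : (forall i, \sum_o u i o = 1) ->
  \sum_(y | agree L j (imp L j i) y x && (irank L j i (y i) < r)%N) prodm u y =
  prefixm u (imp L j i) x * \sum_(o in top L j i r) u i o.
Proof.
move=> u1.
have := sum_prodm u (fun i' o => if (imp L j i' < imp L j i)%N then o == x i'
                     else (i' == i) ==> (irank L j i o < r)%N).
rewrite (bigID (fun i' => (imp L j i' < imp L j i)%N)) /= => eq_u.
transitivity (\prod_(i' | (imp L j i' < imp L j i)%N)
    (\sum_(o | if (imp L j i' < imp L j i)%N then o == x i'
               else (i' == i) ==> (irank L j i o < r)%N) u i' o) *
  \prod_(i' | ~~ (imp L j i' < imp L j i)%N)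
    (\sum_(o | if (imp L j i' < imp L j i)%N then o == x i'
               else (i' == i) ==> (irank L j i o < r)%N) u i' o)).
  rewrite -eq_u; apply: eq_bigl => y.
  apply/andP/forallP => [[/agreeP agr lt_r] i'|ok].
    case: ifP => [lt|_]; first by rewrite agr.
    by apply/implyP=> /eqP->.
  have := ok i; rewrite ltnn eqxx; split=> //.
  by apply/agreeP=> i' lt; have := ok i'; rewrite lt => /eqP.
congr (_ * _).
  apply: eq_bigr => i' lt; rewrite (eq_bigl (pred1 (x i'))) ?big_pred1_eq // => o.
  by rewrite lt.
rewrite (bigD1 i) ?ltnn //= [X in _ * X]big1 ?mulr1 => [|i' /andP[/negPf nlt /negPf ne]].
  by apply: eq_bigl => o; rewrite eqxx inE.
by rewrite -[RHS](u1 i'); apply: eq_bigl => o; rewrite nlt ne.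
Qed.

(** Interpolates between the upper contour mass at [m = 0] and the single value [f x] at [m = p]. *)
Definition tailm (f : bundle n p -> R) m x :=
  \sum_(y | agree L j m y x && lexle L j y x) f y.

Lemma tailm0 f x : tailm f 0 x = \sum_(y | lexpref L j y x || (y == x)) f y.
Proof. by apply: eq_bigl => y; rewrite agree0. Qed.

(** [g] acts as the conditional upper contour mass given agreement on the first types; stating it as
    a factor avoids dividing by a [prefixm] that may be [0]. *)
Lemma tailm_prodmS u i x g : (forall i, \sum_o u i o = 1) ->
    tailm (prodm u) (imp L j i).+1 x = prefixm u (imp L j i).+1 x * g ->
  tailm (prodm u) (imp L j i) x = prefixm u (imp L j i) x *
    (\sum_(o in top L j i (irank L j i (x i))) u i o + u i (x i) * g).
Proof.
move=> u1 eq_g; rewrite /tailm lexle_sumS -/(tailm _ _ _) eq_g.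
by rewrite sum_prodm_agree // prefixmS mulrDr mulrA.
Qed.

Lemma ptype_imp m : (m < p)%N -> exists i, m = imp L j i.
Proof.
by move=> lt; exists (ptype L j (Ordinal lt)); rewrite /ptype permKV.
Qed.

Lemma tailm_prodm u d m x :
    (forall i, \sum_o u i o = 1) -> (forall i o, 0 <= u i o) -> (m + d)%N = p ->
  exists2 g, tailm (prodm u) m x = prefixm u m x * g & 0 <= g <= 1.
Proof.
move=> u1 u_ge0; elim: d m => [|d IH] m.
  rewrite addn0 => ->; exists 1; last by rewrite ler01 lexx.
  rewrite mulr1 /tailm lexle_sum_full; apply: eq_bigl => i.
  by rewrite ltn_ord.
rewrite addnS -addSn => eq_p; have [g eq_g g01] := IH _ eq_p.
have [|i eq_i] := @ptype_imp m; first by rewrite -eq_p ltnS leq_addr.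
rewrite eq_i in eq_g *; eexists; first exact: tailm_prodmS eq_g.
have sum_ge0 (A : {set 'I_n}) : 0 <= \sum_(o in A) u i o by rewrite sumr_ge0.
case/andP: g01 => g_ge0 g_le1.
rewrite addr_ge0 ?mulr_ge0 ?u_ge0 //=.
apply: le_trans (_ : \sum_(o in top L j i (irank L j i (x i)).+1) u i o <= 1).
  by rewrite sum_top_rank addrC lerD2r ler_piMr.
rewrite -(u1 i) [leRHS](bigID [in top L j i (irank L j i (x i)).+1]) /= lerDl.
by rewrite sumr_ge0.
Qed.

End ProductMeasure.

(** * Envy-freeness and efficiency of products of eating shares *)

Section SdProperties.
Variables (R : realFieldType) (n p : nat) (L : lexprofile n p).
Variables (s : 'I_n -> 'I_p -> 'I_n -> R) (T : 'I_p -> 'I_n -> R).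
Hypothesis es : eating_shares L s T.
Implicit Types (j k : 'I_n) (i : 'I_p) (x y : bundle n p).

Let s_row j i : \sum_o s j i o = 1.
Proof. exact: shares_row es _ _. Qed.

Let s_ge0 j i o : 0 <= s j i o.
Proof. exact: shares_ge0 es _ _ _. Qed.

(** Backward induction, [d] being the number of types left; [a] and [b] act as conditional upper
    contour masses. When the two agents eat the next type of [j] in different phases, crude bounds
    on the remainder suffice and the induction hypothesis is not called. *)
Lemma tailm_envy j k x d m : (m + d)%N = p ->
    (forall i, (imp L j i < m)%N -> imp L k i = imp L j i) ->
  exists a b, [/\ tailm L j (prodm (s j)) m x = prefixm L j (s j) m x * a,
    tailm L j (prodm (s k)) m x = prefixm L j (s k) m x * b &
    [/\ 0 <= b, b <= a & a <= 1]].
Proof.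
elim: d m => [|d IH] m.
  rewrite addn0 => -> _; exists 1, 1; split; rewrite ?mulr1 ?ler01 ?lexx //;
  by rewrite /tailm lexle_sum_full; apply: eq_bigl => i; rewrite ltn_ord.
rewrite addnS -addSn => eq_p imp_eq.
have [|i eq_i] := @ptype_imp _ _ L j m; first by rewrite -eq_p ltnS leq_addr.
rewrite eq_i in eq_p imp_eq *.
set r := irank L j i (x i).
set Fj := \sum_(o in top L j i r) s j i o.
set Fk := \sum_(o in top L j i r) s k i o.
have FjS := sum_top_rank L (s j i) j i (x i); rewrite -/r -/Fj in FjS.
have FkS := sum_top_rank L (s k i) j i (x i); rewrite -/r -/Fk in FkS.
have Fj_ge0 : 0 <= Fj by rewrite sumr_ge0.
have Fk_ge0 : 0 <= Fk by rewrite sumr_ge0.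
have sj_ge0 := s_ge0 j i (x i).
have sk_ge0 := s_ge0 k i (x i).
have FjS_le1 := share_le_top es j i r.+1; rewrite FjS in FjS_le1.
(* The earlier places in the order of [j] hold the same types for [k], so [i] cannot come earlier
   for [k]. *)
have imp_le : (imp L j i <= imp L k i)%N.
  rewrite leqNgt; apply/negP => imp_lt.
  have [i' eq_i'] := @ptype_imp _ _ L j (imp L k i) (ltn_ord _).
  have := imp_eq i'; rewrite -eq_i' => /(_ imp_lt); rewrite -(val_inj eq_i') => /perm_inj ii'.
  by move: imp_lt; rewrite eq_i' ii' ltnn.
have step a' b' :
    tailm L j (prodm (s j)) (imp L j i).+1 x = prefixm L j (s j) (imp L j i).+1 x * a' ->
    tailm L j (prodm (s k)) (imp L j i).+1 x = prefixm L j (s k) (imp L j i).+1 x * b' ->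
    0 <= a' <= 1 -> 0 <= b' ->
    Fk + s k i (x i) * b' <= Fj + s j i (x i) * a' ->
  exists a b,
    [/\ tailm L j (prodm (s j)) (imp L j i) x = prefixm L j (s j) (imp L j i) x * a,
      tailm L j (prodm (s k)) (imp L j i) x = prefixm L j (s k) (imp L j i) x * b &
      [/\ 0 <= b, b <= a & a <= 1]].
  move=> eq_a eq_b /andP[a'_ge0 a'_le1] b'_ge0 le.
  exists (Fj + s j i (x i) * a'), (Fk + s k i (x i) * b').
  split; [exact: tailm_prodmS eq_a|exact: tailm_prodmS eq_b|split=> //].
    by rewrite addr_ge0 // mulr_ge0.
  by apply: le_trans FjS_le1; rewrite addrC lerD2r ler_piMr.
move: imp_le; rewrite leq_eqVlt => /predU1P[eq_jk | lt_jk].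
  have [|a' [b' [eq_a eq_b [b'_ge0 le_ba a'_le1]]]] := IH _ eq_p.
    move=> i'; rewrite ltnS leq_eqVlt => /predU1P[/val_inj/perm_inj->|/imp_eq //].
    exact/esym/val_inj.
  have a'_ge0 := le_trans b'_ge0 le_ba.
  apply: step eq_a eq_b _ b'_ge0 _; first by rewrite a'_ge0.
  have le1 := share_envy_free es r (esym (val_inj eq_jk)).
  have le2 := share_envy_free es r.+1 (esym (val_inj eq_jk)).
  rewrite FjS FkS in le2; rewrite -/Fj -/Fk in le1.
  apply: le_trans (_ : Fk + s k i (x i) * a' <= _).
    by rewrite lerD2l ler_wpM2l.
  (* [F + s * a'] is the convex combination of [F] and [F + s] with weights [1 - a'] and [a'], and
     [j] dominates at both. *)
  have h1 : 0 <= (1 - a') * (Fj - Fk) by rewrite mulr_ge0 ?subr_ge0.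
  have h2 : 0 <= a' * (s j i (x i) + Fj - (s k i (x i) + Fk)).
    by rewrite mulr_ge0 ?subr_ge0.
  have -> : Fj + s j i (x i) * a' = Fk + s k i (x i) * a' +
    ((1 - a') * (Fj - Fk) + a' * (s j i (x i) + Fj - (s k i (x i) + Fk))) by lra.
  by rewrite lerDl addr_ge0.
have [a' eq_a a'01] := tailm_prodm L j x (s_row j) (s_ge0 j) eq_p.
have [b' eq_b b'01] := tailm_prodm L j x (s_row k) (s_ge0 k) eq_p.
have [a'_ge0 a'_le1] := andP a'01; have [b'_ge0 b'_le1] := andP b'01.
apply: step eq_a eq_b a'01 b'_ge0 _.
have skb_le : s k i (x i) * b' <= s k i (x i) by rewrite ler_piMr.
have sja_ge0 : 0 <= s j i (x i) * a' by rewrite mulr_ge0.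
have FkS_le1 : s k i (x i) + Fk <= 1.
  rewrite -FkS -(s_row k i) [leRHS](bigID [in top L j i r.+1]) /= lerDl.
  by rewrite sumr_ge0.
(* If [j] does not fill up with [x i] and better items, [k] gets none of them; if she fills up
   before [x i], her side is at least [1]. Otherwise [x i] is her last item, and [k] gets at most
   what [j] leaves of it. *)
have [FjS_lt1|FjS_ge1] := ltP (s j i (x i) + Fj) 1.
  have := share_later_eq0 (r := r.+1) es lt_jk; rewrite FjS FkS => /(_ FjS_lt1).
  lra.
have [Fj_lt1|Fj_ge1] := ltP Fj 1; last by lra.
have Fk0 : Fk = 0 by exact: (share_later_eq0 (r := r) es lt_jk).
suff : s j i (x i) + s k i (x i) <= 1 by lra.
rewrite -(shares_col es i (x i)) (bigD1 j) //= (bigD1 k) /=; last first.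
  by apply: contraTneq lt_jk => ->; rewrite ltnn.
by rewrite addrA lerDl sumr_ge0.
Qed.

Lemma prodm_envy_free j k : sd_dominates (lexpref L j) (prodm (s j)) (prodm (s k)).
Proof.
move=> x; have [||a [b []]] := @tailm_envy j k x p 0 => //.
rewrite !tailm0 => -> -> [_ le_ba _].
by rewrite /prefixm !big_pred0 ?mul1r.
Qed.

Section Efficient.
Variable Q : assignment n p R.
Hypothesis Q_assign : is_assignment Q.
Hypothesis Q_dom : forall j, sd_dominates (lexpref L j) (Q j) (prodm (s j)).

Let Q_ge0 j y : 0 <= Q j y.
Proof. by case: Q_assign => /(_ j y)/andP[]. Qed.

Let q j i o := \sum_(y : bundle n p | y i == o) Q j y.

Let sum_q j i (A : {set 'I_n}) : \sum_(o in A) q j i o = \sum_(y : bundle n p | y i \in A) Q j y.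
Proof.
rewrite (partition_big (fun y : bundle n p => y i) [in A]) //=.
apply: eq_bigr => o oA; apply: eq_bigl => y.
by case: eqP => [->|]; rewrite ?oA ?andbF.
Qed.

(** It ranges over all agents at once, since equality in one phase comes from the supplies that they
    share. *)
Definition same_prefix m := forall j i x r, (imp L j i < m)%N -> (r <= n)%N ->
  \sum_(y | agree L j (imp L j i) y x && (irank L j i (y i) < r)%N) Q j y =
  \sum_(y | agree L j (imp L j i) y x && (irank L j i (y i) < r)%N) prodm (s j) y.

(** Each type before phase [m] splits off a mass on which both sides agree by [same_prefix];
    cancelling these leaves dominance of the tails. *)
Lemma tailm_le m j x : (m <= p)%N -> same_prefix m ->
  tailm L j (prodm (s j)) m x <= tailm L j (Q j) m x.
Proof.
elim: m => [|m IH] le_mp same.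
  by rewrite !tailm0; apply: Q_dom.
have [i eq_i] := @ptype_imp _ _ L j m le_mp; rewrite eq_i in same *.
have : tailm L j (prodm (s j)) (imp L j i) x <= tailm L j (Q j) (imp L j i) x.
  rewrite -eq_i; apply: IH; first exact: ltnW.
  by move=> j' i' x' r' lt; apply: same; rewrite -eq_i ltnS ltnW.
rewrite /tailm !lexle_sumS same //; last exact: ltnW.
by rewrite lerD2l.
Qed.

Lemma agree_top_le j i x r : (r <= n)%N -> same_prefix (imp L j i) ->
  \sum_(y | agree L j (imp L j i) y x && (irank L j i (y i) < r)%N) prodm (s j) y <=
  \sum_(y | agree L j (imp L j i) y x && (irank L j i (y i) < r)%N) Q j y.
Proof.
move=> le_rn same; case: r le_rn => [|r] lt_rn.
  by rewrite !big_pred0 // => y; rewrite ltn0 andbF.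
(* [b] has rank exactly [r], so being at least as good as [b] means rank below [r.+1]; the
   components less important than [i] will be set to their worst items. *)
pose b := ((irank L j i)^-1)%g (Ordinal lt_rn).
pose xb : bundle n p := [ffun i' => if i' == i then b else x i'].
have lt_n : (n.-1 < n)%N by rewrite ltn_predL (leq_ltn_trans _ (ltn_ord j)).
pose w i' := ((irank L j i')^-1)%g (Ordinal lt_n).
have worst i' a : (irank L j i' a <= irank L j i' (w i'))%N.
  by rewrite permKV /= -ltnS prednK ?ltn_ord // (leq_ltn_trans _ (ltn_ord j)).
have := tailm_le j [ffun i' => if (imp L j i' <= imp L j i)%N then xb i' else w i']
  (ltnW (ltn_ord _)) same.
rewrite /tailm !(eq_bigl _ _ (lexle_worst i xb worst)).
suff E y : agree L j (imp L j i) y xb && (irank L j i (y i) <= irank L j i (xb i))%N =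
    agree L j (imp L j i) y x && (irank L j i (y i) < r.+1)%N.
  by rewrite !(eq_bigl _ _ E).
congr (_ && _); last by rewrite ffunE eqxx permKV.
apply/agreeP/agreeP => agr i' lt; rewrite agr // ffunE ifN //;
by apply: contraTneq lt => ->; rewrite ltnn.
Qed.

Lemma marginal_le j i r : (r <= n)%N -> same_prefix (imp L j i) ->
  \sum_(o in top L j i r) s j i o <= \sum_(o in top L j i r) q j i o.
Proof.
move=> le_rn same; rewrite sum_q -(prodm_marginal _ [in top L j i r]) //.
pose x : bundle n p := [ffun=> j].
rewrite (sum_agree L j _ (imp L j i) x) [leRHS](sum_agree L j _ (imp L j i) x).
apply: ler_sum => z _.
have E y : agree L j (imp L j i) y z && (y i \in top L j i r) =
    agree L j (imp L j i) y z && (irank L j i (y i) < r)%N by rewrite inE.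
by rewrite !(eq_bigl _ _ E) agree_top_le.
Qed.

(** [dominating_top] turns the dominance of marginals into equality. A marginal is a sum over
    prefixes of terms compared by [agree_top_le], so each of these comparisons is an equality
    too. *)
Lemma same_prefixS m : same_prefix m -> same_prefix m.+1.
Proof.
move=> same j i x r; rewrite ltnS => le_im le_rn.
have same_le j' i' : (imp L j' i' <= m)%N -> same_prefix (imp L j' i').
  by move=> le j2 i2 x2 r2 lt2; apply: same; apply: leq_trans le.
have q_ge0 j' i' o : 0 <= q j' i' o by rewrite sumr_ge0.
have q_row j' i' : \sum_o q j' i' o = 1.
  have [_ Q_row _] := Q_assign; rewrite -(Q_row j').
  by rewrite [RHS](partition_big (fun y : bundle n p => y i') xpredT).
have q_col i' o : \sum_j' q j' i' o = 1.
  by have [_ _ Q_col] := Q_assign; apply: Q_col.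
have q_dom j' i' r' : (imp L j' i' <= m)%N -> (r' <= n)%N ->
    \sum_(o in top L j' i' r') s j' i' o <= \sum_(o in top L j' i' r') q j' i' o.
  by move=> le_m le_r; apply: marginal_le => //; apply: same_le.
have eq_q := dominating_top es q_ge0 q_row q_col q_dom le_im le_rn.
rewrite sum_q -(prodm_marginal _ [in top L j i r]) // in eq_q.
rewrite [LHS](sum_agree L j _ (imp L j i) x) in eq_q.
rewrite [RHS](sum_agree L j _ (imp L j i) x) in eq_q.
move/eqP: eq_q; rewrite -subr_eq0 -sumrB.
have E z y : agree L j (imp L j i) y z && (y i \in top L j i r) =
    agree L j (imp L j i) y z && (irank L j i (y i) < r)%N by rewrite inE.
rewrite psumr_eq0 => [/allP/(_ x)|z _]; last first.
  by rewrite subr_ge0 !(eq_bigl _ _ (E z)) agree_top_le //; apply: same_le.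
rewrite mem_index_enum => /(_ isT)/implyP.
rewrite subr_eq0 !(eq_bigl _ _ (E x)) => /(_ _)/eqP -> //.
by apply/eqP/ffunP=> i'; rewrite ffunE if_same.
Qed.

(** At [m = p], [tailm_le] compares single entries, and both rows sum to [1]. *)
Lemma dominating_eq j x : Q j x = prodm (s j) x.
Proof.
have same m : same_prefix m by elim: m => // m; apply: same_prefixS.
have le y : prodm (s j) y <= Q j y.
  by have := tailm_le j y (leqnn p) (same p); rewrite /tailm !lexle_sum_full.
have /eqP : \sum_y (Q j y - prodm (s j) y) = 0.
  by rewrite sumrB sum_prodm1 //; case: Q_assign => _ -> _; rewrite subrr.
rewrite psumr_eq0 => [/allP/(_ x)|y _]; last by rewrite subr_ge0.
by rewrite mem_index_enum subr_eq0 => /(_ isT)/eqP.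
Qed.

End Efficient.
End SdProperties.

(** * Hall's marriage theorem *)

Section Hall.
Variables I U : finType.
Implicit Types (A B : {set I}) (E : I -> {set U}).

(* Halmos-Vaughan: if some proper nonempty [B] is tight, match [B] and its
   complement separately; otherwise any single edge can be removed. *)
Theorem hall_marriage (f0 : I -> U) E A :
    (forall B, B \subset A -> (#|B| <= #|\bigcup_(b in B) E b|)%N) ->
  exists2 f : I -> U, {in A &, injective f} & forall a, a \in A -> f a \in E a.
Proof.
have [N] := ubnP #|A|; elim: N A E => // N IH A E; rewrite ltnS => card_A hall.
have [->|[a aA]] := set_0Vmem A.
  by exists f0 => [b c|b]; rewrite inE.
have sub1 b : b \in A -> [set b] \subset A by rewrite sub1set.
case: (boolP [exists B : {set I}, [&& B \proper A, B != set0 &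
    (#|\bigcup_(b in B) E b| <= #|B|)%N]]) => [/existsP[B]|no].
  case/and3P=> BA B0 tight; have [sBA [c cA cB]] := properP BA.
  have [|C sCB|f f_inj fE] := IH B E.
  - by apply: leq_trans card_A; apply: proper_card.
  - by apply: hall; apply: subset_trans sBA.
  set NB := \bigcup_(b in B) E b in tight.
  have [|C sC|g g_inj gE] := IH (A :\: B) (fun b => E b :\: NB).
  - apply: leq_trans card_A; apply/proper_card/properP; split; first exact: subsetDl.
    by have [b bB] := set0Pn _ B0; exists b; rewrite ?inE ?bB ?(subsetP sBA).
  - have disjCB : [disjoint C & B].
      apply/pred0P=> b /=; apply/negbTE/negP=> /andP[/(subsetP sC)].
      by rewrite inE => /andP[/negPf->].
    have sCBA : C :|: B \subset A by rewrite subUset sBA (subset_trans sC) ?subsetDl.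
    (* Hall's condition for [C :|: B], less the tight part [B], gives it for [C] with [NB]
       removed. *)
    have := hall _ sCBA; rewrite cardsU (disjoint_setI0 disjCB) cards0 subn0 => le1.
    have sub2 : \bigcup_(b in C :|: B) E b \subset
        NB :|: \bigcup_(b in C) (E b :\: NB).
      apply/bigcupsP=> b bCB; apply/subsetP=> u uE; rewrite inE.
      case: (boolP (u \in NB)) => //= uNB; apply/bigcupP; exists b.
        case/setUP: bCB => // bB; case/negP: uNB.
        by apply/bigcupP; exists b.
      by rewrite inE uNB.
    have := leq_trans le1 (leq_trans (subset_leq_card sub2) (leq_card_setU _ _)).
    by rewrite addnC => /leq_trans/(_ (leq_add tight (leqnn _))); rewrite leq_add2l.
  have h_NB b : b \in B -> f b \in NB by move=> bB; apply/bigcupP; exists b; rewrite ?fE.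
  exists (fun b => if b \in B then f b else g b) => [b b' bA b'A|b bA].
    have gNB d : d \in A -> d \notin B -> g d \notin NB.
      by move=> dA dB; have := gE d; rewrite !inE dA dB => /(_ isT)/andP[].
    case: ifPn => bB; case: ifPn => b'B; first exact: f_inj.
    - by move=> eq_fg; have := gNB b' b'A b'B; rewrite -eq_fg h_NB.
    - by move=> eq_fg; have := gNB b bA bB; rewrite eq_fg h_NB.
    - by apply: g_inj; rewrite inE ?bB ?b'B.
  case: ifPn => bB; first exact: fE.
  by have := gE b; rewrite !inE bA bB => /(_ isT)/andP[].
have [u uE] : exists u, u \in E a.
  apply/set0Pn; rewrite -card_gt0.
  by have := hall _ (sub1 a aA); rewrite cards1 big_set1.
have [|C sC|g g_inj gE] := IH (A :\ a) (fun b => E b :\ u).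
- by apply: leq_trans card_A; apply: proper_card; apply: properD1.
- have [->|C0] := eqVneq C set0; first by rewrite cards0.
  have CA : C \proper A by apply: sub_proper_trans sC (properD1 aA).
  (* No nonempty proper subset is tight, so there is a spare neighbour to pay for the removal of
     [u]. *)
  have lt_C : (#|C| < #|\bigcup_(b in C) E b|)%N.
    by rewrite ltnNge; apply: contra no => tight; apply/existsP; exists C; rewrite CA C0.
  have sub3 : (\bigcup_(b in C) E b) :\ u \subset \bigcup_(b in C) (E b :\ u).
    apply/subsetP=> v; rewrite !inE => /andP[vu /bigcupP[b bC vE]].
    by apply/bigcupP; exists b; rewrite // !inE vu.
  apply: leq_trans (subset_leq_card sub3); rewrite -ltnS (leq_trans lt_C) //.
  by rewrite (cardsD1 u) -add1n leq_add2r; case: (_ \in _).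
have gu b : b \in A -> b != a -> g b != u.
  by move=> bA ba; have := gE b; rewrite !inE bA ba => /(_ isT)/andP[].
exists (fun b => if b == a then u else g b) => [b b' bA b'A|b bA].
  case: eqVneq => [->|ba]; case: eqVneq => [->|b'a] //.
  - by move=> /esym/eqP; rewrite (negPf (gu b' b'A b'a)).
  - by move=> /eqP; rewrite (negPf (gu b bA ba)).
  - by apply: g_inj; rewrite !inE ?ba ?b'a.
case: eqVneq => [->//|ba].
by have := gE b; rewrite !inE bA ba => /(_ isT)/andP[].
Qed.

End Hall.

(** * Birkhoff's theorem for nonnegative matrices with constant row and column sums *)

Section Birkhoff.
Variables (R : realFieldType) (n : nat).
Implicit Types (A : 'I_n -> 'I_n -> R) (c : R).

(** Hall's condition by counting mass: the rows of [B] carry [c * #|B|], all inside the columns of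
    their neighbours, each of which carries [c]. *)
Lemma support_perm A c : 0 < c -> (forall i j, 0 <= A i j) ->
    (forall i, \sum_j A i j = c) -> (forall j, \sum_i A i j = c) ->
  exists f : {perm 'I_n}, forall i, 0 < A i (f i).
Proof.
move=> c_gt0 A_ge0 row col; pose E i := [set j | 0 < A i j].
have [B _|f f_inj fE] := @hall_marriage _ _ id E setT.
  rewrite -(ler_nat R) -(ler_pM2r c_gt0) !mulr_natl.
  rewrite -(sumr_const _ c) (eq_bigr (fun i => \sum_j A i j)) // -sumr_const.
  rewrite [leRHS](eq_bigr (fun j => \sum_i A i j)) // exchange_big /=.
  rewrite [leLHS](bigID [in \bigcup_(b in B) E b]) /= addrC big1 ?add0r => [|j jN].
    apply: ler_sum => j _; rewrite [leRHS](bigID [in B]) /= lerDl sumr_ge0 //.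
  rewrite big1 // => i iB; apply/le_anti; rewrite A_ge0 andbT leNgt.
  by apply: contra jN => Aij; apply/bigcupP; exists i; rewrite ?inE.
have f_inj' : injective f by move=> i j; apply: f_inj; rewrite inE.
by exists (perm f_inj') => i; have := fE i; rewrite permE !inE; apply.
Qed.

(** Subtracting [m] times a permutation in the support either exhausts [c] or removes a positive
    entry; the induction is on the number of positive entries, plus one if [c] is nonzero. *)
Theorem birkhoff A c : 0 <= c -> (forall i j, 0 <= A i j) ->
    (forall i, \sum_j A i j = c) -> (forall j, \sum_i A i j = c) ->
  exists w : {perm 'I_n} -> R, [/\ forall f, 0 <= w f, \sum_f w f = c &
    forall i j, A i j = \sum_f w f * (f i == j)%:R].
Proof.
have [N] := ubnP (#|[set ij | (0 < A ij.1 ij.2)%R]| + (c != 0)%R)%N.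
elim: N A c => // N IH A c; rewrite ltnS => le_N c_ge0 A_ge0 row col.
have [c0|c_neq0] := eqVneq c 0.
  exists (fun=> 0); split=> // [|i j]; first by rewrite big1.
  rewrite big1 => [|f _]; last by rewrite mul0r.
  have /eqP := row i; rewrite c0 psumr_eq0 // => /allP/(_ j).
  by rewrite mem_index_enum => /(_ isT)/eqP.
have c_gt0 : 0 < c by rewrite lt_def c_neq0.
have [f f_gt0] := support_perm c_gt0 A_ge0 row col.
(* The default [c] matters for [n = 0], where there are no entries and [c] is unconstrained by
   them. *)
pose m := \big[Num.min/c]_i A i (f i).
have m_ge0 : 0 <= m by apply/bigmin_geP; split.
have m_le i : m <= A i (f i) by apply: bigmin_le.
have m_att : m = c \/ exists i, m = A i (f i).
  rewrite /m; elim/big_rec: _ => [|i d _ IHd]; first by left.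
  by case: leP => _ //; right; exists i.
pose A' i j := A i j - m * (f i == j)%:R.
have A'_le i j : A' i j <= A i j by rewrite lerBlDr lerDl mulr_ge0 ?ler0n.
have A'_ge0 i j : 0 <= A' i j.
  by rewrite /A'; case: eqP => [<-|_]; rewrite ?mulr1 ?mulr0 ?subr0 ?subr_ge0.
have [| | | |w [w_ge0 w_sum wE]] := IH A' (c - m) _ _ A'_ge0.
- apply: leq_trans le_N.
  have subA : [set ij | 0 < A' ij.1 ij.2] \subset [set ij | 0 < A ij.1 ij.2].
    by apply/subsetP=> [[i j]]; rewrite !inE => /lt_le_trans; apply.
  rewrite c_neq0; case: m_att => [->|[i mi]].
    by rewrite subrr eqxx addn1 ltnS addn0 subset_leq_card.
  rewrite -addSn; apply: leq_add; last exact: leq_b1.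
  apply/proper_card/properP; split=> //; exists (i, f i); rewrite !inE //=.
  by rewrite /A' eqxx mulr1 -mi subrr ltxx.
- by rewrite subr_ge0; apply: bigmin_le_id.
- move=> i; rewrite sumrB row; congr (_ - _).
  rewrite (bigD1 (f i)) //= eqxx mulr1 big1 ?addr0 // => j /negPf ne.
  by rewrite eq_sym ne mulr0.
- move=> j; rewrite sumrB col; congr (_ - _).
  rewrite (bigD1 ((f^-1)%g j)) //= permKV eqxx mulr1 big1 ?addr0 // => i ne.
  by rewrite -(inj_eq (@perm_inj _ (f^-1)%g)) permK (negPf ne) mulr0.
exists (fun g => w g + (if g == f then m else 0)); split.
- by move=> g; rewrite addr_ge0 //; case: ifP.
- by rewrite big_split /= w_sum -big_mkcond big_pred1_eq subrK.
move=> i j; under eq_bigr do rewrite mulrDl.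
rewrite big_split /= -wE (bigD1 f) //= eqxx big1 ?addr0 ?subrK // => g /negPf->.
by rewrite mul0r.
Qed.

End Birkhoff.

(** * Decomposition into discrete assignments *)

Section Decomposition.
Variables (R : realFieldType) (n p : nat).

(** Expanding the product over types of sums over permutations gives one term per family [g] of
    permutations; in its assignment [D g], agent [j] receives the item [g i j] of each type [i]. *)
Lemma prodm_decomposable (s : 'I_n -> 'I_p -> 'I_n -> R) (P : assignment n p R) :
    (forall j i o, 0 <= s j i o) -> (forall j i, \sum_o s j i o = 1) ->
    (forall i o, \sum_j s j i o = 1) -> (forall j x, P j x = prodm (s j) x) ->
  decomposable P.
Proof.
move=> s_ge0 s_row s_col PE.
have bvn i := birkhoff ler01 (fun j o => s_ge0 j i o) (fun j => s_row j i) (s_col i).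
have [w wP] := fin_all_exists bvn.
pose F := {ffun 'I_p -> {perm 'I_n}}.
pose D (g : F) : assignment n p R :=
  [ffun j => [ffun x => (x == [ffun i => g i j])%:R]].
have DE g j x : D g j x = (x == [ffun i => g i j])%:R by rewrite !ffunE.
pose W (g : F) := \prod_i w i (g i).
have sumF (h : F -> R) : \sum_(k < #|F|) h (enum_val k) = \sum_g h g.
  by rewrite -big_enum_val.
exists #|F|, (fun k => W (enum_val k)), (fun k => D (enum_val k)); split.
- by move=> k; apply: prodr_ge0 => i _; case: (wP i).
- rewrite (sumF W) -(bigA_distr_bigA w) big1 // => i _.
  by case: (wP i).
- move=> k; move: (enum_val k) => g; split; last first.
    by move=> j x; rewrite DE; case: eqP; [right|left].
  split.
  - by move=> j x; rewrite DE ler0n lern1 leq_b1.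
  - move=> j; rewrite (bigD1 [ffun i => g i j]) //= DE eqxx big1 ?addr0 // => x.
    by rewrite DE => /negPf->.
  (* Under [g], item [o] of type [i] goes to the agent [(g i)^-1 o] alone. *)
  - move=> i o; rewrite (bigD1 ((g i)^-1%g o)) //= [X in _ + X]big1 => [|j ne].
      rewrite (bigD1 [ffun i' => g i' ((g i)^-1%g o)]) /=; last by rewrite ffunE permKV.
      by rewrite DE eqxx big1 ?addr0 // => x /andP[_ /negPf ne]; rewrite DE ne.
    rewrite big1 // => x /eqP xo; rewrite DE; case: eqP => // xE.
    by case/eqP: ne; rewrite -xo xE ffunE permK.
move=> j x; rewrite (sumF (fun g => W g * D g j x)) PE.
rewrite /prodm (eq_bigr (fun i => \sum_f w i f * (f j == x i)%:R)); last first.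
  by move=> i _; case: (wP i) => _ _ ->.
rewrite bigA_distr_bigA; apply: eq_bigr => g _.
rewrite big_split /= DE; congr (_ * _).
case: eqP => [->|ne]; first by rewrite big1 // => i _; rewrite ffunE eqxx.
apply/eqP/prodf_eq0; have /existsP[i ne_i] : [exists i, g i j != x i].
  rewrite -negb_forall; apply/negP=> /forallP eq; apply: ne.
  by apply/ffunP=> i; rewrite ffunE (eqP (eq i)).
by exists i; rewrite // (negPf ne_i).
Qed.

End Decomposition.

Theorem theorem2 (R : realFieldType) (n p : nat) (L : lexprofile n p) :
  sd_efficient L (LexiPS L R) /\ sd_envy_free L (LexiPS L R) /\ decomposable (LexiPS L R).
Proof.
have [T es] := lexips_eating R L.
have PE j x : LexiPS L R j x = prodm (lexips_shares L R j) x by rewrite !ffunE.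
split; last split.
- case=> Q [Q_assign neq dom]; apply: neq; apply/ffunP=> j; apply/ffunP=> x.
  rewrite PE; apply: (dominating_eq es Q_assign) => {}j {}x.
  by under eq_bigr do rewrite -PE; apply: dom.
- move=> j k x; under eq_bigr do rewrite PE.
  by under [leRHS]eq_bigr do rewrite PE; apply: prodm_envy_free es j k x.
exact: (prodm_decomposable (shares_ge0 es) (shares_row es) (shares_col es) PE).
Qed.
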